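(* Let $\mathcal A$ be a finite-dimensional real algebra, endowed with a positive-definite scalar product $(\cdot,\cdot)$, which is commutative ($u\cdot v=v\cdot u$), associative, and symmetric, i.e. $(u,v\cdot w)=(v\cdot u,w)$ for all $u,v,w\in\mathcal A$. Then $\mathcal A$ is the direct sum of one-dimensional ideals.
   Context: ''Algebra'' means a real vector space with a bilinear product, not assumed unital. In terms of structure constants $a^a_{bc}$ defined by $(x\cdot y)^a=a^a_{bc}x^by^c$ and $a_{abc}=k_{ad}a^d_{bc}$, with $k_{ab}$ the matrix of the scalar product, commutativity together with symmetry means that $a_{abc}$ is totally symmetric in its three indices. *)

(* Defs.v *)
From HB Require Import structures.
From mathcomp Require Import all_boot all_order all_algebra.
From mathcomp Require Import sesquilinear reals.

Set Implicit Arguments.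
Unset Strict Implicit.
Unset Printing Implicit Defensive.

Import GRing.Theory.
Local Open Scope ring_scope.

(* [mul] is not assumed unital, associative or commutative, so no MathComp
   algebra structure on [V] applies and ideals are defined here directly.
   Being a linear subspace is part of the type of [I]. *)
Definition two_sided_ideal (R : realType) (V : vectType R)
    (mul : {bilinear V -> V -> V}) (I : {vspace V}) : Prop :=
  forall x y : V, y \in I -> mul x y \in I /\ mul y x \in I.

(* Main.v *)
(* The multiplication operators are self-adjoint and commute, so the eigenspace
   of one of them inside an ideal is again an ideal.  Shrinking a nonzero ideal
   in this way ends when every multiplication acts on it as a scalar, and then
   each of its lines is an ideal.  By symmetry the orthogonal complement of an
   ideal is an ideal, so such a line splits off and one continues in its
   complement. *)

Require Import Defs.
From HB Require Import structures.
From mathcomp Require Import all_boot all_order all_algebra.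
From mathcomp Require Import sesquilinear reals complex boolp.

Set Implicit Arguments.
Unset Strict Implicit.
Unset Printing Implicit Defensive.

Import Order.TTheory GRing.Theory Num.Theory VectorInternalTheory passmx.
Local Open Scope ring_scope.

(* The real and imaginary parts of a complex eigenvector for [a + i b]. *)
Lemma mx_complex_eigenvector (R : rcfType) (n : nat) (A : 'M[R]_n) :
  (0 < n)%N ->
  exists (a b : R) (u v : 'rV[R]_n),
    [/\ (u != 0) || (v != 0), u *m A = a *: u - b *: v
      & v *m A = b *: u + a *: v].
Proof.
move=> n_gt0; pose B := map_mx (real_complex R) A.
(* Over the closed field of complex numbers, a characteristic polynomial of degree [n > 0] has a
   root. *)
have [z] : exists z, root (char_poly B) z.
  by apply/closed_rootP; rewrite size_char_poly eqSS -lt0n.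
rewrite -eigenvalue_root_char => /eigenvalueP[w wB w_neq0].
case: z wB => a b wB; exists a, b, (map_mx (@complex.Re R) w), (map_mx (@complex.Im R) w).
have ReD : {morph @complex.Re R : x y / x + y} by move=> [? ?] [? ?].
have ImD : {morph @complex.Im R : x y / x + y} by move=> [? ?] [? ?].
split.
- apply: contraNT w_neq0; rewrite negb_or !negbK => /andP[/eqP u0 /eqP v0].
  apply/eqP/rowP => j; apply/eqP; rewrite eq_complex.
  move/rowP/(_ j): u0; move/rowP/(_ j): v0.
  by rewrite !mxE => -> ->; rewrite !eqxx.
- apply/rowP => j; move/rowP/(_ j)/(congr1 (@complex.Re R)): wB.
  rewrite !mxE (big_morph _ ReD (erefl _)); case: (w 0 j) => x y /= <-.
  by apply: eq_bigr => k _; rewrite !mxE; case: (w 0 k) => p q /=; rewrite mulr0 subr0.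
- apply/rowP => j; move/rowP/(_ j)/(congr1 (@complex.Im R)): wB.
  rewrite !mxE (big_morph _ ImD (erefl _)); case: (w 0 j) => x y /=; rewrite addrC => <-.
  by apply: eq_bigr => k _; rewrite !mxE; case: (w 0 k) => p q /=; rewrite mulr0 add0r.
Qed.

(** Stability of [W] makes the restriction of [f] an endomorphism [g] of the space [subvs_of W]; the
    matrix lemma applies to [g] in coordinates, and [vsval] carries the result back to [V]. *)
Lemma lfun_complex_eigenvector (R : rcfType) (V : vectType R) (f : 'End(V))
    (W : {vspace V}) :
  W != 0%VS -> (f @: W <= W)%VS ->
  exists (a b : R) (u v : V),
    [/\ u \in W, v \in W, (u != 0) || (v != 0), f u = a *: u - b *: v
      & f v = b *: u + a *: v].
Proof.
move=> W_neq0 fW.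
pose g : 'End(subvs_of W) := linfun (vsproj W \o f \o vsval).
have gE x : vsval (g x) = f (vsval x).
  rewrite lfunE /= vsprojK //.
  by apply: (subvP fW); rewrite memv_img ?subvsP.
pose A := lin1_mx (v2r \o g \o r2v).
have dim_gt0 : (0 < dim (subvs_of W))%N.
  by rewrite [dim _]/(\dim W) lt0n dimv_eq0.
have [a [b [u [v [uv_neq0 uA vA]]]]] :=
  mx_complex_eigenvector A dim_gt0.
have gr x : g (r2v x) = r2v (x *m A).
  by rewrite mul_rV_lin1 /= v2rK.
exists a, b, (vsval (r2v u)), (vsval (r2v v)); split; rewrite ?subvsP //.
- move: uv_neq0; rewrite -!(can_eq r2vK) !linear0.
  by rewrite -!(inj_eq val_inj) /= .
- by rewrite -gE gr uA linearB !linearZ.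
- by rewrite -gE gr vA linearD !linearZ.
Qed.

Section DotProduct.

Variables (R : numDomainType) (V : lmodType R) (dot : {dot V for idfun}).

Lemma dotC u v : dot u v = dot v u.
Proof. by rewrite hermC expr0 mul1r. Qed.

Lemma dot_gt0 u : u != 0 -> 0 < dot u u.
Proof. exact: neq0_dnorm_gt0. Qed.

Lemma dot_ge0 u : 0 <= dot u u.
Proof. by have [->|/dot_gt0/ltW//] := eqVneq u 0; rewrite linear0r. Qed.

Lemma dot_eq0 u : (dot u u == 0) = (u == 0).
Proof.
by have [->|/dot_gt0/gt_eqF//] := eqVneq u 0; rewrite linear0r eqxx.
Qed.

End DotProduct.

(* For a complex eigenvector [u + i v] with eigenvalue [a + i b],
   self-adjointness gives [b (|u|^2 + |v|^2) = 0], so [b = 0]. *)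
Lemma self_adjoint_eigenvector (R : rcfType) (V : vectType R)
    (dot : {dot V for idfun}) (f : 'End(V)) (W : {vspace V}) :
  (forall u v, dot (f u) v = dot u (f v)) ->
  W != 0%VS -> (f @: W <= W)%VS ->
  exists a w, [/\ w \in W, w != 0 & f w = a *: w].
Proof.
move=> f_sym W_neq0 fW.
have [a [b [u [v [uW vW uv_neq0 fu fv]]]]] := lfun_complex_eigenvector W_neq0 fW.
have /eqP : b * (dot u u + dot v v) = 0.
  have := f_sym u v; rewrite fu fv linearBl linearDr.
  rewrite !linearZl_LR !linearZr_LR /= => h.
  apply: (addrI (a * dot u v - b * dot v v)).
  by rewrite addr0 {2}h mulrDr [b * _ + b * _]addrC addrA subrK addrC.
rewrite mulf_eq0 paddr_eq0 ?dot_ge0 // !dot_eq0 => /orP[/eqP b0|uv0].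
  (* Once [b = 0], both [u] and [v] satisfy the eigenvalue equation for [a]; whichever is nonzero
     serves. *)
  have [u0|u_neq0] := eqVneq u 0; last by exists a, u; rewrite fu b0 scale0r subr0.
  exists a, v; rewrite fv b0 scale0r add0r; split=> //.
  by move: uv_neq0; rewrite u0 eqxx.
by move: uv_neq0; rewrite -negb_and uv0.
Qed.

Section Ideals.

Variables (R : realType) (V : vectType R).
Variables (mul : {bilinear V -> V -> V}) (dot : {dot V for idfun}).
Hypothesis mul_comm : forall u v : V, mul u v = mul v u.
Hypothesis mul_assoc : forall u v w : V, mul (mul u v) w = mul u (mul v w).
Hypothesis mul_symm : forall u v w : V, dot u (mul v w) = dot (mul v u) w.

Lemma idealP (I : {vspace V}) :
  (forall x y, y \in I -> mul x y \in I) -> two_sided_ideal mul I.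
Proof. by move=> h x y yI; rewrite (mul_comm y); split; exact: h. Qed.

Lemma ideal_cap (I J : {vspace V}) :
  two_sided_ideal mul I -> two_sided_ideal mul J ->
  two_sided_ideal mul (I :&: J)%VS.
Proof.
move=> hI hJ; apply: idealP => x y; rewrite !memv_cap => /andP[yI yJ].
by rewrite (hI x y yI).1 (hJ x y yJ).1.
Qed.

Lemma mem_leigenspace (x y : V) (a : R) :
  (y \in leigenspace (linfun (mul x)) a) = (mul x y == a *: y).
Proof. by rewrite memv_ker add_lfunE opp_lfunE scale_lfunE id_lfunE lfunE /= subr_eq0. Qed.

(** If [x y = a y], then [x (z y) = (x z) y = (z x) y = z (x y) = a (z y)]. *)
Lemma leigenspace_ideal (x : V) (a : R) :
  two_sided_ideal mul (leigenspace (linfun (mul x)) a).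
Proof.
apply: idealP => z y; rewrite !mem_leigenspace => /eqP xy.
by rewrite -mul_assoc (mul_comm x) mul_assoc xy linearZr_LR.
Qed.

Lemma ideal_contains_line (W : {vspace V}) :
  two_sided_ideal mul W -> W != 0%VS ->
  exists v, [/\ v \in W, v != 0 & two_sided_ideal mul <[v]>%VS].
Proof.
move: {2}(\dim W).+1 (ltnSn (\dim W)) => n.
elim: n W => // n IHn W dimW hW W_neq0.
(* The scalar may depend on [x] but not on [w]. If every [x] acts on [W] in this way, any nonzero
   vector of [W] spans an ideal. *)
have [scalar|] := pselect (forall x, exists a, forall w, w \in W -> mul x w = a *: w).
  exists (vpick W); rewrite memv_pick vpick0; split=> //.
  apply: idealP => x _ /vlineP[k ->]; have [a xE] := scalar x.
  by rewrite linearZr_LR xE ?memv_pick //= !memvZ ?memv_line.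
move/existsNP => [x /forallNP not_scalar].
pose f := linfun (mul x).
have fW : (f @: W <= W)%VS.
  by apply/subvP => _ /memv_imgP[y yW ->]; rewrite lfunE; exact: (hW x y yW).1.
have f_sym u v : dot (f u) v = dot u (f v) by rewrite !lfunE /= mul_symm.
have [a [w [wW w_neq0 fw]]] := self_adjoint_eigenvector f_sym W_neq0 fW.
pose E := (W :&: leigenspace f a)%VS.
have wE : w \in E by rewrite memv_cap wW mem_leigenspace -fw lfunE /=.
(* Equal dimensions would force [E = W], so that [x] would act on [W] as the scalar [a], against its
   choice. *)
have dimE : (\dim E < n)%N.
  rewrite -ltnS (leq_trans _ dimW) // ltnS ltn_neqAle dimvS ?capvSl // andbT.
  apply/negP => /eqP dimEW; apply: (not_scalar a) => y yW.
  have /eqP EW : E == W by rewrite eqEdim capvSl dimEW leqnn.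
  by apply/eqP; rewrite -mem_leigenspace; move: yW; rewrite -{1}EW memv_cap => /andP[].
have E_neq0 : E != 0%VS.
  by apply: contraNneq w_neq0 => E0; rewrite -memv0 -E0.
have [v [vE v_neq0 hv]] := IHn E dimE (ideal_cap hW (@leigenspace_ideal x a)) E_neq0.
by exists v; split=> //; move: vE; rewrite memv_cap => /andP[].
Qed.

(** Recording the lines by spanning vectors turns directness of their sum into freeness of [s],
    which grows by one vector at each induction step. *)
Lemma ideal_basis (W : {vspace V}) :
  two_sided_ideal mul W ->
  exists2 s : seq V, basis_of W s & {in s, forall v, two_sided_ideal mul <[v]>%VS}.
Proof.
move: {2}(\dim W).+1 (ltnSn (\dim W)) => n.
elim: n W => // n IHn W dimW hW.
have [->|W_neq0] := eqVneq W 0%VS.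
  by exists [::] => //; exact: nil_basis.
have [v [vW v_neq0 hv]] := ideal_contains_line hW W_neq0.
(* The kernel of [f] is the orthogonal complement of [v], and [W'] is its part inside [W]. *)
pose f : 'Hom(V, R^o) := linfun (dot v : V -> R^o).
have mem_ker y : (y \in lker f) = (dot v y == 0) by rewrite memv_ker lfunE.
pose W' := (W :&: lker f)%VS.
have v_notin : v \notin W' by rewrite memv_cap mem_ker dot_eq0 (negPf v_neq0) andbF.
(* Since [x v = k v] for some [k], symmetry gives [(v, x y) = (x v, y) = k (v, y) = 0]. *)
have hker : two_sided_ideal mul (lker f).
  apply: idealP => x y; rewrite !mem_ker mul_symm => /eqP vy.
  have /vlineP[k ->] := (hv x v (memv_line v)).1.
  by rewrite linearZl_LR /= vy mulr0.
have W'E : W = (<[v]> + W')%VS.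
  apply/eqP; rewrite eqEsubv subv_add -memvE vW capvSl !andbT.
  (* Here [k v] is the orthogonal projection of [y] onto the line of [v], so [y - k v] lies in
     [W']. *)
  apply/subvP => y yW; pose k := dot v y / dot v v.
  rewrite -(subrK (k *: v) y) addrC memv_add ?memvZ ?memv_line //.
  rewrite memv_cap memvB ?memvZ // mem_ker linearBr linearZr_LR /=.
  by rewrite divfK ?dot_eq0 // subrr.
have dimW' : (\dim W' < n)%N.
  rewrite -ltnS (leq_trans _ dimW) // ltnS ltn_neqAle dimvS ?capvSl // andbT.
  apply: contra v_notin => /eqP dimE.
  by have /eqP -> : W' == W by rewrite eqEdim capvSl dimE leqnn.
have [s s_basis hs] := IHn W' dimW' (ideal_cap hW hker).
exists (v :: s); last by move=> u; rewrite inE => /predU1P[->//|/hs].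
rewrite /basis_of span_cons free_cons (span_basis s_basis) v_notin.
by rewrite (basis_free s_basis) -W'E eqxx.
Qed.

End Ideals.

Theorem mainTheorem3 (R : realType) (V : vectType R)
    (mul : {bilinear V -> V -> V}) (dot : {dot V for idfun})
    (mul_comm : forall u v : V, mul u v = mul v u)
    (mul_assoc : forall u v w : V, mul (mul u v) w = mul u (mul v w))
    (mul_symm : forall u v w : V, dot u (mul v w) = dot (mul v u) w) :
  exists (n : nat) (I : 'I_n -> {vspace V}),
    [/\ forall i, two_sided_ideal mul (I i),
        forall i, \dim (I i) = 1%N,
        directv (\sum_(i < n) I i)%VS
      & (\sum_(i < n) I i)%VS = fullv].
Proof.
have hfull : two_sided_ideal mul fullv by move=> x y _; rewrite !memvf.
have [s s_basis hs] := ideal_basis mul_comm mul_assoc mul_symm hfull.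
have s_free := basis_free s_basis.
have sum_lines : (\sum_(i < size s) <[s`_i]>)%VS = fullv.
  by rewrite -(span_basis s_basis) span_def (big_nth 0) big_mkord.
have dim_line (i : 'I_(size s)) : \dim <[s`_i]> = 1%N.
  by rewrite dim_vline (free_not0 s_free) // mem_nth.
exists (size s), (fun i => <[s`_i]>%VS); split=> // [i|].
  by apply: hs; rewrite mem_nth.
(* Directness means that the dimension of the sum is the sum of the dimensions; both equal
   [size s]. *)
apply/directvP => /=; rewrite sum_lines (eq_bigr (fun=> 1%N)) //.
by rewrite sum1_card card_ord (size_basis (X := in_tuple s) s_basis).
Qed.
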